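(* Let $X=[0,1]$ or $X=\mathbb S^1$, with its usual metric $d$. For each $a\in[0,1]$ there exists a continuous map $\phi_a:X\to X$ with $\mathrm{mdim}_M(X,\phi_a,d)=a$ (i.e. $\underline{\mathrm{mdim}_M}(X,\phi_a,d)=\overline{\mathrm{mdim}_M}(X,\phi_a,d)=a$).
   Context: Let $(X,d)$ be a compact metric space and $\phi:X\to X$ continuous. For $n\ge1$ let $d_n(x,y)=\max_{0\le j<n}d(\phi^j(x),\phi^j(y))$. For $\varepsilon>0$, $\mathrm{sep}(n,\phi,\varepsilon)$ is the maximal cardinality of a set $A\subset X$ with $d_n(x,y)>\varepsilon$ for any two distinct $x,y\in A$, and $\mathrm{sep}(\phi,\varepsilon)=\limsup_{n\to\infty}\frac1n\log\mathrm{sep}(n,\phi,\varepsilon)$. The lower and upper metric mean dimensions are $$\underline{\mathrm{mdim}_M}(X,\phi,d)=\liminf_{\varepsilon\to0}\frac{\mathrm{sep}(\phi,\varepsilon)}{|\log\varepsilon|},\qquad \overline{\mathrm{mdim}_M}(X,\phi,d)=\limsup_{\varepsilon\to0}\frac{\mathrm{sep}(\phi,\varepsilon)}{|\log\varepsilon|}.$$ Convention: $\mathrm{mdim}_M$ without a bar refers to both the upper and the lower metric mean dimension. On $[0,1]$ the usual metric is $d(x,y)=|x-y|$. *)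

(* Defs.v *)
From HB Require Import structures.
From mathcomp Require Import all_boot all_order all_algebra finmap.
From mathcomp Require Import ring lra.
From mathcomp Require Import all_classical all_reals all_analysis.

Set Implicit Arguments.
Unset Strict Implicit.
Unset Printing Implicit Defensive.

Import Order.TTheory GRing.Theory Num.Theory.
Import numFieldNormedType.Exports.

Local Open Scope classical_set_scope.
Local Open Scope ring_scope.

Section MetricMeanDimension.
Context {R : realType} {X : metricType R}.
Implicit Types (phi : X -> X) (n : nat) (eps : R).

(* Distances are nonnegative, so 0 is neutral for this maximum when 0 < n. *)
Definition bowen_dist phi n (x y : X) : R :=
  \big[Num.max/0]_(j < n) mdist (iter j phi x) (iter j phi y).

Definition separated phi n eps (A : {fset X}) : Prop :=
  forall x y, x \in A -> y \in A -> x != y -> eps < bowen_dist phi n x y.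

(* The supremum is attained, hence a maximum, when X is compact, phi is
   continuous and 0 < n, 0 < eps. *)
Definition sep_card phi n eps : \bar R :=
  ereal_sup [set (#|` A|%fset%:R)%:E | A in separated phi n eps].

(* The index n = 0, where n%:R^-1 = 0, does not affect the limit superior. *)
Definition sep_rate phi eps : \bar R :=
  limn_esup (fun n => ((n%:R^-1)%:E * lne (sep_card phi n eps))%E).

Definition lower_mdim phi : \bar R :=
  limf_einf (fun eps => (sep_rate phi eps * (`|ln eps|^-1)%:E)%E) 0^'+.

Definition upper_mdim phi : \bar R :=
  limf_esup (fun eps => (sep_rate phi eps * (`|ln eps|^-1)%:E)%E) 0^'+.

End MetricMeanDimension.

Definition unit_interval (R : realType) : Type := {x : R | 0 <= x <= 1}.

Section UnitInterval.
Variable R : realType.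
Let I := unit_interval R.

HB.instance Definition _ := SubChoice.copy I {x : R | 0 <= x <= 1}.

Definition interval_dist (x y : I) : R := `|val x - val y|.

Let distxx x : interval_dist x x = 0.
Proof. by rewrite /interval_dist subrr normr0. Qed.

Let dist_pos x y : interval_dist x y = 0 -> x = y.
Proof. by move/normr0_eq0/subr0_eq => xy; apply: val_inj. Qed.

Let dist_sym x y : interval_dist x y = interval_dist y x.
Proof. exact: distrC. Qed.

Let dist_triangle y x z :
  interval_dist x z <= interval_dist x y + interval_dist y z.
Proof. exact: ler_distD. Qed.

HB.instance Definition _ :=
  @isMetric.Build R I interval_dist distxx dist_pos dist_sym dist_triangle.

End UnitInterval.

Definition circle (R : realType) : Type :=
  {p : R * R | p.1 ^+ 2 + p.2 ^+ 2 == 1}.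

Section Circle.
Variable R : realType.
Let S := circle R.

HB.instance Definition _ :=
  SubChoice.copy S {p : R * R | p.1 ^+ 2 + p.2 ^+ 2 == 1}.

(* The Euclidean distance; the library norm on R * R is the sup norm. *)
Definition circle_dist (p q : S) : R :=
  Num.sqrt (((val p).1 - (val q).1) ^+ 2 + ((val p).2 - (val q).2) ^+ 2).

Let distxx p : circle_dist p p = 0.
Proof. by rewrite /circle_dist !subrr expr0n addr0 sqrtr0. Qed.

Let dist_pos p q : circle_dist p q = 0 -> p = q.
Proof.
move/eqP; rewrite sqrtr_eq0 => le0; apply: val_inj.
have : ((val p).1 - (val q).1) ^+ 2 + ((val p).2 - (val q).2) ^+ 2 == 0.
  by rewrite eq_le le0 addr_ge0 ?sqr_ge0.
rewrite paddr_eq0 ?sqr_ge0// !sqrf_eq0 !subr_eq0 => /andP[/eqP e1 /eqP e2].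
by move: e1 e2; case: (val p) (val q) => [? ?] [? ?] /= -> ->.
Qed.

Let dist_sym p q : circle_dist p q = circle_dist q p.
Proof. by rewrite /circle_dist -sqrrN opprB -[X in _ + X]sqrrN opprB. Qed.

Let minkowski (a b c d : R) :
  Num.sqrt ((a + c) ^+ 2 + (b + d) ^+ 2) <=
  Num.sqrt (a ^+ 2 + b ^+ 2) + Num.sqrt (c ^+ 2 + d ^+ 2).
Proof.
set u := Num.sqrt (a ^+ 2 + b ^+ 2); set v := Num.sqrt (c ^+ 2 + d ^+ 2).
have u0 : 0 <= u by exact: sqrtr_ge0.
have v0 : 0 <= v by exact: sqrtr_ge0.
have uE : u ^+ 2 = a ^+ 2 + b ^+ 2 by rewrite sqr_sqrtr// addr_ge0 ?sqr_ge0.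
have vE : v ^+ 2 = c ^+ 2 + d ^+ 2 by rewrite sqr_sqrtr// addr_ge0 ?sqr_ge0.
have CS : a * c + b * d <= u * v.
  apply: le_trans (ler_norm _) _.
  rewrite -[leRHS]ger0_norm ?mulr_ge0// -ler_sqr ?nnegrE// !real_normK ?num_real//.
  rewrite exprMn uE vE -subr_ge0.
  have -> : (a ^+ 2 + b ^+ 2) * (c ^+ 2 + d ^+ 2) - (a * c + b * d) ^+ 2 =
            (a * d - b * c) ^+ 2 by ring.
  exact: sqr_ge0.
rewrite -[leRHS]ger0_norm ?addr_ge0// -sqrtr_sqr ler_sqrt ?sqr_ge0//.
have -> : (u + v) ^+ 2 = u ^+ 2 + v ^+ 2 + 2 * (u * v) by ring.
by rewrite uE vE; lra.
Qed.

Let dist_triangle q p r : circle_dist p r <= circle_dist p q + circle_dist q r.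
Proof.
rewrite /circle_dist; apply: le_trans (minkowski _ _ _ _).
by rewrite !addrA !subrK.
Qed.

HB.instance Definition _ :=
  @isMetric.Build R S circle_dist distxx dist_pos dist_sym dist_triangle.

End Circle.

(* Main.v *)
(** Cut [0, 1] into the blocks [b_(k+1), b_k] with b_k = exp(-(1-a)k)/(k+1),
    and let the map fold each block onto itself by a zigzag with s_k ~ exp(ak)
    linear branches.  At scale eps = exp(-T) only the blocks k < K with K ~ T
    matter: their Markov itineraries give an entropy at most log s_K ~ aT,
    while the remaining tail [0, b_K] is invariant and is covered by
    b_K / eps ~ exp(aK) cells.  Conversely the k-th horseshoe is visible at
    every scale below (b_k - b_(k+1)) / s_k = exp(-k + O(log k)) and has
    entropy at least ak.  Hence sep(phi, eps) = (a + o(1)) |log eps|.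

    The circle retracts by a Lipschitz map onto an arc that is bi-Lipschitz to
    [0, 1]; composing with the retraction carries the interval map over. *)

Require Import Defs.
From mathcomp Require Import all_boot all_order all_algebra finmap.
From mathcomp Require Import ring lra.
From mathcomp Require Import all_classical all_reals all_analysis.

Import Order.TTheory GRing.Theory Num.Theory.
Import numFieldNormedType.Exports.

Local Open Scope classical_set_scope.
Local Open Scope ring_scope.

(** * Zigzag and sawtooth maps *)

Section Zigzag.
Context {R : realType}.
Implicit Types (u v x : R) (i n : nat).

(** Distance from [u] to the nearest even integer: a triangle wave of period 2 with slopes 1 and
    -1. *)
Definition zig u : R := `|u - 2 * (Num.floor ((u + 1) / 2))%:~R|.

Lemma zig_ge0 u : 0 <= zig u. Proof. exact: normr_ge0. Qed.

Lemma zig_le1 u : zig u <= 1.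
Proof.
have /andP[] := floor_itv ((u + 1) / 2); rewrite intrD /zig ler_norml => h1 h2.
by apply/andP; split; lra.
Qed.

Lemma zig_near (m : int) u : `|u - 2 * m%:~R| <= 1 -> zig u = `|u - 2 * m%:~R|.
Proof.
rewrite ler_norml => /andP[ml mh].
have /andP[] := floor_itv ((u + 1) / 2); rewrite intrD /zig.
set M := Num.floor _ => Ml Mh; have [Mm|mM|->//] := ltgtP M m.
  have : M%:~R + 1 <= m%:~R :> R by rewrite -(intrD _ M 1) ler_int lezD1.
  lra.
(* The only possible disagreement is a tie: [u] is the odd integer midway between [2 * m] and
   [2 * M], at distance 1 from both. *)
have mM1 : m%:~R + 1 <= M%:~R :> R by rewrite -(intrD _ m 1) ler_int lezD1.
have -> : u - 2 * m%:~R = 1 by lra.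
have -> : u - 2 * M%:~R = - 1 by lra.
by rewrite normrN.
Qed.

Lemma zig_le (m : int) u : zig u <= `|u - 2 * m%:~R|.
Proof.
have [/zig_near ->//|] := leP `|u - 2 * m%:~R| 1.
by move/ltW; apply: le_trans (zig_le1 u).
Qed.

(** By [zig_le], [zig] is a minimum of 1-Lipschitz functions; compare [x] with the even integer
    nearest to [y]. *)
Lemma zig_lip u v : `|zig u - zig v| <= `|u - v|.
Proof.
suff h x y : zig x - zig y <= `|x - y|.
  by rewrite ler_norml lerNl opprB {1}distrC !h.
rewrite lerBlDr; apply: le_trans (zig_le (Num.floor ((y + 1) / 2)) x) _.
exact: ler_distD.
Qed.

Lemma zig_even i x : 0 <= x <= 1 -> zig (2 * i%:R + x) = x.
Proof.
move=> /andP[x0 x1]; rewrite (zig_near i%:Z) -pmulrn addrAC subrr add0r.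
  by rewrite ger0_norm.
by rewrite ger0_norm.
Qed.

Lemma zig_odd i x : 0 <= x <= 1 -> zig (2 * i%:R + 1 + x) = 1 - x.
Proof.
move=> /andP[x0 x1]; have e : 2 * i%:R + 1 + x - 2 * i.+1%:R = - (1 - x) :> R.
  by rewrite -natr1; ring.
by rewrite (zig_near i.+1%:Z) -pmulrn e normrN ger0_norm ?subr_ge0//; lra.
Qed.

(** Equal integer parts [n] put [u] and [v] on one linear branch, increasing if [n] is even and
    decreasing if [n] is odd. *)
Lemma zig_isometric u v : 0 <= u -> 0 <= v -> Num.truncn u = Num.truncn v ->
  `|zig u - zig v| = `|u - v|.
Proof.
move=> u0 v0 uv; have /andP[ul uh] := truncn_itv u0; have := truncn_itv v0.
rewrite -uv; move: ul uh; set n := Num.truncn u => ul uh /andP[vl vh].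
have := odd_double_half n; set m := n./2; case: (odd n) => /= nE.
  have nR : n%:R = 2 * m%:R + 1 :> R by rewrite -nE natrD -mul2n natrM addrC.
  move: ul uh vl vh; rewrite -!natr1 nR => ul uh vl vh.
  rewrite (_ : u = 2 * m%:R + 1 + (u - (2 * m%:R + 1))); last by ring.
  rewrite (_ : v = 2 * m%:R + 1 + (v - (2 * m%:R + 1))); last by ring.
  rewrite !zig_odd; [|by apply/andP; split; lra..].
  by rewrite distrC; congr `|_|; ring.
have nR : n%:R = 2 * m%:R :> R by rewrite -nE add0n -mul2n natrM.
move: ul uh vl vh; rewrite -!natr1 nR => ul uh vl vh.
rewrite (_ : u = 2 * m%:R + (u - 2 * m%:R)); last by ring.
rewrite (_ : v = 2 * m%:R + (v - 2 * m%:R)); last by ring.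
by rewrite !zig_even; [congr `|_|; ring|apply/andP; split; lra..].
Qed.

End Zigzag.

(** * Itineraries and coded orbits of the sawtooth map *)

Section Sawtooth.
Context {R : realType}.
Implicit Types (u v : R) (s i j t N : nat) (w : seq nat).

Lemma natr_doubleS t : t.*2.+1%:R = 2 * t%:R + 1 :> R.
Proof. by rewrite -addn1 natrD -mul2n natrM. Qed.

Definition saw s u : R := zig (s%:R * u).

Lemma saw_itv s u : 0 <= saw s u <= 1.
Proof. by rewrite zig_ge0 zig_le1. Qed.

Lemma iter_saw_itv s j u : 0 <= u <= 1 -> 0 <= iter j (saw s) u <= 1.
Proof. by case: j => //= j _; exact: saw_itv. Qed.

Lemma saw_lip s u v : `|saw s u - saw s v| <= s%:R * `|u - v|.
Proof.
by apply: le_trans (zig_lip _ _) _; rewrite -mulrBr normrM ger0_norm.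
Qed.

Lemma saw0 s : saw s 0 = 0.
Proof.
rewrite /saw mulr0; have := @zig_even R 0 0.
by rewrite !addr0 mulr0 lexx ler01; apply.
Qed.

(** An odd number of branches fixes both endpoints, which lets neighbouring blocks be glued
    continuously. *)
Lemma saw1 t : saw t.*2.+1 1 = 1.
Proof.
rewrite /saw mulr1 natr_doubleS; have := @zig_odd R t 0.
by rewrite addr0 subr0 lexx ler01; apply.
Qed.

(** The truncation of [s * x] is the index of the linear branch containing [x]; the endpoint 1 gets
    the extra index [s]. *)
Definition same_itinerary s N u v :=
  forall j, (j < N)%N ->
    Num.truncn (s%:R * iter j (saw s) u) = Num.truncn (s%:R * iter j (saw s) v).

(** As long as two orbits share branches, each step multiplies their distance by exactly [s]. *)
Lemma saw_expand s N u v : 0 <= u <= 1 -> 0 <= v <= 1 ->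
  same_itinerary s N u v ->
  s%:R ^+ N * `|u - v| = `|iter N (saw s) u - iter N (saw s) v|.
Proof.
elim: N u v => [|N IH] u v u01 v01 uv; first by rewrite mul1r.
rewrite !iterSr -IH ?saw_itv//; last by move=> j jN; rewrite -!iterSr; exact: uv.
rewrite {2}/saw zig_isometric; last exact: (uv 0%N).
- by rewrite -mulrBr normrM normr_nat mulrA exprSr.
- by rewrite mulr_ge0//; case/andP: u01.
- by rewrite mulr_ge0//; case/andP: v01.
Qed.

Lemma same_itinerary_near s N u v : 0 <= u <= 1 -> 0 <= v <= 1 ->
  same_itinerary s N u v -> s%:R ^+ N * `|u - v| <= 1.
Proof.
move=> u01 v01 /(saw_expand _ _ _ _ u01 v01) ->.
have /andP[u0 u1] := iter_saw_itv s N _ u01.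
have /andP[v0 v1] := iter_saw_itv s N _ v01.
by rewrite ler_norml; apply/andP; split; lra.
Qed.

(* Only the [t.+1] increasing branches are used as letters: any two of them are
   separated by a gap of length [1 / s]. *)
Fixpoint coded_point t w : R :=
  if w is i :: w' then (2 * i%:R + coded_point t w') / t.*2.+1%:R else 0.

Lemma coded_point_itv t w : all (leq^~ t) w -> 0 <= coded_point t w <= 1.
Proof.
elim: w => [|i w IH] /=; first by rewrite lexx ler01.
move=> /andP[it /IH /andP[p0 p1]].
rewrite divr_ge0 ?addr_ge0 ?mulr_ge0//= ler_pdivrMr ?ltr0n// mul1r.
rewrite natr_doubleS; move: it; rewrite -(ler_nat R); lra.
Qed.

(** Prepending a letter picks an inverse branch, so the sawtooth acts on coded points as the shift
    on words. *)
Lemma saw_coded_point t i w : all (leq^~ t) w ->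
  saw t.*2.+1 (coded_point t (i :: w)) = coded_point t w.
Proof.
move=> /coded_point_itv p01; rewrite /saw /= mulrCA divff ?mulr1 ?pnatr_eq0//.
exact: zig_even.
Qed.

(** Shifting up to the first differing letter puts the two points on distinct increasing
    branches. *)
Lemma coded_point_sep t w w' : all (leq^~ t) w -> all (leq^~ t) w' ->
  size w = size w' -> w != w' -> exists2 j, (j < size w)%N &
    (t.*2.+1%:R)^-1 <= `|iter j (saw t.*2.+1) (coded_point t w) -
                         iter j (saw t.*2.+1) (coded_point t w')|.
Proof.
elim: w w' => [|i w IH] [|i' w']// /andP[it wt] /andP[i't w't] [ww'].
have [<-|ii' _] := eqVneq i i'.
  rewrite eqseq_cons eqxx /= => /(IH _ wt w't ww')[j jw jsep].
  by exists j.+1 => //; rewrite !iterSr !saw_coded_point.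
(* The numerators differ by at least 2 - 1: distinct letters contribute at least 2, and the
   remaining coded points lie in [0, 1]. *)
exists 0%N => //=; rewrite -mulrBl normrM (gtr0_norm (x := _^-1)) ?invr_gt0 ?ltr0n//.
apply: ler_peMl; first by rewrite invr_ge0.
have /andP[p0 p1] := coded_point_itv _ _ wt.
have /andP[q0 q1] := coded_point_itv _ _ w't.
by move: ii'; rewrite neq_ltn => /orP[]; rewrite -(ler_nat R) -natr1 => ii';
   [rewrite ltr0_norm|rewrite gtr0_norm]; lra.
Qed.

End Sawtooth.

Section TruncatedCells.
Context {R : realType}.
Implicit Types u v : R.

(** [inord] collapses out-of-range values, hence the bounds; the alphabet has [M.+1] letters because
    the truncation equals [M] at the right end. *)
Lemma inord_truncn_inj M u v : 0 <= u <= M%:R -> 0 <= v <= M%:R ->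
  inord (Num.truncn u) = inord (Num.truncn v) :> 'I_M.+1 ->
  Num.truncn u = Num.truncn v.
Proof.
have h (w : R) : 0 <= w <= M%:R -> (Num.truncn w < M.+1)%N.
  by move=> /andP[w0 wM]; rewrite truncn_lt_nat// -natr1; lra.
by move=> /h uM /h vM /(congr1 val); rewrite /= !inordK.
Qed.

Lemma truncn_eq_lt1 u v : 0 <= u -> 0 <= v -> Num.truncn u = Num.truncn v ->
  `|u - v| < 1.
Proof.
move=> /truncn_itv/andP[ul uh] /truncn_itv/andP[vl vh] uv; move: ul uh.
rewrite uv => ul uh; rewrite -natr1 in uh vh.
by rewrite ltr_norml; apply/andP; split; lra.
Qed.

End TruncatedCells.

(** * Separation rates *)

Section LimSup.
Context {T : choiceType} {X : filteredType T} {R : realType}.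
Implicit Types (f : X -> \bar R) (F : set_system X) (l : \bar R).

Lemma limf_esup_le_near f F l : (\forall x \near F, (f x <= l)%E) ->
  (limf_esup f F <= l)%E.
Proof.
move=> fl; apply: ge_ereal_inf; exists (ereal_sup (f @` [set x | (f x <= l)%E])).
  by exists [set x | (f x <= l)%E].
by apply: ge_ereal_sup => _ [x ? <-].
Qed.

Lemma limf_esup_ge_near f F l : ProperFilter F ->
  (\forall x \near F, (l <= f x)%E) -> (l <= limf_esup f F)%E.
Proof.
move=> FF fl; apply: le_ereal_inf_tmp => _ [V FV <-].
have [x [Vx lx]] := filter_ex (filterI FV fl).
by apply: le_trans lx _; apply: ereal_sup_ubound; exists x.
Qed.

Lemma limf_einf_ge_near f F l : (\forall x \near F, (l <= f x)%E) ->
  (l <= limf_einf f F)%E.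
Proof.
move=> fl; rewrite limf_einfE; apply: le_ereal_sup_tmp.
exists (ereal_inf (f @` [set x | (l <= f x)%E])).
  by exists [set x | (l <= f x)%E].
by apply: le_ereal_inf_tmp => _ [x ? <-].
Qed.

Lemma limf_einf_le_esup f F : ProperFilter F -> (limf_einf f F <= limf_esup f F)%E.
Proof.
move=> FF; rewrite limf_einfE limf_esupE; apply: ge_ereal_sup => _ [V FV <-].
apply: le_ereal_inf_tmp => _ [W FW <-].
have [x [Vx Wx]] := filter_ex (filterI FV FW).
apply: (@le_trans _ _ (f x)); first by apply: ereal_inf_lbound; exists x.
by apply: ereal_sup_ubound; exists x.
Qed.

End LimSup.

Section Separation.
Context {R : realType} {X : metricType R}.
Implicit Types (phi : X -> X) (n : nat) (eps : R).

Lemma bowen_dist_ge0 phi n x y : 0 <= bowen_dist phi n x y.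
Proof. by rewrite /bowen_dist; elim/big_rec: _ => // i z _ z0; rewrite le_max z0 orbT. Qed.

Lemma bowen_dist_le phi n x y e : 0 <= e ->
  (forall j, (j < n)%N -> mdist (iter j phi x) (iter j phi y) <= e) ->
  bowen_dist phi n x y <= e.
Proof.
move=> e0 h; rewrite /bowen_dist; elim/big_rec: _ => // i z _ z0.
by rewrite ge_max h.
Qed.

Lemma bowen_dist_ge phi n x y j : (j < n)%N ->
  mdist (iter j phi x) (iter j phi y) <= bowen_dist phi n x y.
Proof.
by move=> jn; rewrite /bowen_dist (bigD1 (Ordinal jn))//= le_max lexx.
Qed.

Lemma bowen_distxx phi n x : bowen_dist phi n x x = 0.
Proof.
apply/eqP; rewrite eq_le bowen_dist_ge0 andbT; apply: bowen_dist_le => // j _.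
by rewrite mdistxx.
Qed.

(** Pigeonhole: distinct points of a separated set cannot share a code, so [c] is injective on
    it. *)
Lemma sep_card_le phi n eps (T : finType) (c : X -> T) :
  (forall x y, c x = c y -> bowen_dist phi n x y <= eps) ->
  (sep_card phi n eps <= #|T|%:R%:E)%E.
Proof.
move=> cP; apply: ge_ereal_sup => _ [A sA <-]; rewrite lee_fin ler_nat.
rewrite cardfE; apply: (leq_card (fun x : A => c (val x))) => x y cxy.
apply: contraTeq (cP _ _ cxy) => xy; rewrite -ltNge; apply: sA => //; exact: valP.
Qed.

Lemma sep_card_ge phi n eps (T : finType) (f : T -> X) : 0 <= eps ->
  (forall u v, u != v -> eps < bowen_dist phi n (f u) (f v)) ->
  (#|T|%:R%:E <= sep_card phi n eps)%E.
Proof.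
move=> e0 fP; have f_inj : injective f.
  move=> u v fuv; apply: contraTeq (e0) => /fP.
  by rewrite fuv bowen_distxx -ltNge.
apply: ereal_sup_ubound; exists [fset f u | u in T]%fset.
  move=> _ _ /imfsetP[u _ ->] /imfsetP[v _ ->] uv; apply: fP.
  by apply: contraNneq uv => ->.
by rewrite card_imfset// -cardE.
Qed.

Lemma sep_rate_le phi eps (M D : R) : 0 < M -> 0 < D ->
  (forall n, (sep_card phi n eps <= (D * M ^+ n)%:E)%E) ->
  (sep_rate phi eps <= (ln M)%:E)%E.
Proof.
move=> M0 D0 h; apply/lee_addgt0Pr => e e0; apply: limf_esup_le_near.
near=> n.
have n0 : 0 < n%:R :> R by rewrite ltr0n; near: n; exact: nbhs_infty_gt.
(* The prefactor [D] contributes [ln D / n], which is eventually at most [e]. *)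
have lnD : ln D <= e * n%:R.
  rewrite mulrC -ler_pdivrMr//; near: n; exact: nbhs_infty_ger.
apply: (@le_trans _ _ ((n%:R^-1)%:E * (ln (D * M ^+ n))%:E)%E).
  rewrite lee_pmul2l ?lte_fin ?invr_gt0// -lne_EFin ?mulr_gt0 ?exprn_gt0//.
  (* When the cardinality is not positive, [lne] is -oo and the bound is automatic. *)
  have [s0|s0] := leP (sep_card phi n eps) 0%E; first by rewrite le0_lneNy ?leNye.
  rewrite lee_lne ?in_itv/= ?leey ?andbT ?(ltW s0)//.
  by rewrite lee_fin mulr_ge0 ?exprn_ge0 ?ltW.
rewrite -EFinM -EFinD lee_fin lnM ?posrE ?exprn_gt0// lnXn// mulrC ler_pdivrMr//.
by rewrite mulrDl -mulr_natr; lra.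
Unshelve. all: by end_near. Qed.

Lemma sep_rate_ge phi eps (M : R) : 0 < M ->
  (forall n, ((M ^+ n)%:E <= sep_card phi n eps)%E) ->
  ((ln M)%:E <= sep_rate phi eps)%E.
Proof.
move=> M0 h; apply: limf_esup_ge_near; near=> n.
have n0 : 0 < n%:R :> R by rewrite ltr0n; near: n; exact: nbhs_infty_gt.
apply: (@le_trans _ _ ((n%:R^-1)%:E * (ln (M ^+ n))%:E)%E).
  by rewrite -EFinM lee_fin lnXn// -[ln M *+ n]mulr_natl mulKf// gt_eqF.
rewrite lee_pmul2l ?lte_fin ?invr_gt0// -lne_EFin ?exprn_gt0//.
have Mn : (0 <= (M ^+ n)%:E)%E by rewrite lee_fin exprn_ge0 ?ltW.
by rewrite lee_lne ?in_itv/= ?leey ?andbT// (le_trans Mn).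
Unshelve. all: by end_near. Qed.

End Separation.

(** * Chains of horseshoes *)

Section ChainOfHorseshoes.
Context {R : realType}.
Variables (b : nat -> R) (t : nat -> nat).
Hypotheses (b0 : b 0%N = 1) (b_gt0 : forall k, 0 < b k).
Hypothesis b_dec : forall k, b k.+1 < b k.
Hypothesis b_small : forall x, 0 < x -> exists k, b k < x.
Hypothesis t_gt0 : forall k, (0 < t k)%N.
Hypothesis t_homo : {homo t : k l / (k <= l)%N}.
Implicit Types (x y u v : R) (j k l n m : nat).

Let s k := (t k).*2.+1.
Let L k := b k - b k.+1.

Definition block_map k x := b k.+1 + L k * saw (s k) ((x - b k.+1) / L k).

(** Blocks are open on the left, so that each point of (0, 1] lies in exactly one; the default 0
    concerns only points outside (0, 1]. *)
Definition block_index x := xget 0%N [set k | b k.+1 < x <= b k].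

Definition chain_map x : R := if 0 < x then block_map (block_index x) x else 0.

Local Notation F := chain_map.

Lemma b_homo k l : (k <= l)%N -> b l <= b k.
Proof.
by move=> /subnK <-; elim: (l - k)%N => // d; apply: le_trans; exact/ltW/b_dec.
Qed.

Lemma b_le1 k : b k <= 1. Proof. by rewrite -b0; exact: b_homo. Qed.

Lemma block_length_gt0 k : 0 < L k. Proof. by rewrite subr_gt0 b_dec. Qed.

Lemma block_length_le1 k : L k <= 1.
Proof. by have := b_le1 k; have := b_gt0 k.+1; rewrite /L; lra. Qed.

(** The least [m] with [b m < x] is nonzero because [b 0 = 1], and its predecessor is the block of
    [x]. *)
Lemma block_indexP x : 0 < x <= 1 ->
  b (block_index x).+1 < x <= b (block_index x).
Proof.
move=> /andP[x0 x1]; have ex : exists k, b k < x by exact: b_small.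
have [k bkx kmin] := ex_minnP ex; rewrite /block_index; case: xgetP => // H.
case: k bkx kmin => [|k] bkx kmin; first by move: bkx; rewrite b0 ltNge x1.
exfalso; apply: (H k); rewrite /= bkx leNgt; apply/negP => /kmin.
by rewrite ltnn.
Qed.

Lemma block_index_eq k x : b k.+1 < x <= b k -> block_index x = k.
Proof.
move=> /andP[xl xh].
have /block_indexP/andP[yl yh] : 0 < x <= 1.
  by rewrite (lt_trans _ xl)//= (le_trans xh)// b_le1.
case: (ltngtP (block_index x) k) => // /b_homo; rewrite leNgt.
  by rewrite (lt_le_trans yl xh).
by rewrite (lt_le_trans xl yh).
Qed.

Lemma block_map_itv k x : b k.+1 <= block_map k x <= b k.
Proof.
have /andP[h0 h1] := saw_itv (s k) ((x - b k.+1) / L k).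
rewrite /block_map lerDl mulr_ge0//=; last exact/ltW/block_length_gt0.
by rewrite -lerBrDl ler_piMr//; exact/ltW/block_length_gt0.
Qed.

Lemma block_map_top k : block_map k (b k) = b k.
Proof. by rewrite /block_map divff ?gt_eqF ?block_length_gt0// saw1 mulr1 addrC subrK. Qed.

Lemma block_map_bot k : block_map k (b k.+1) = b k.+1.
Proof. by rewrite /block_map subrr mul0r saw0 mulr0 addr0. Qed.

(** The left endpoint belongs to block [k.+1], but both block maps fix it. *)
Lemma chain_map_block k x : b k.+1 <= x <= b k -> F x = block_map k x.
Proof.
move=> /andP[xl xh]; have x0 : 0 < x by exact: lt_le_trans xl.
rewrite /F x0; move: xl; rewrite le_eqVlt => /orP[/eqP <-|xl].
  by rewrite (block_index_eq k.+1) ?block_map_top ?block_map_bot// b_dec lexx.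
by rewrite (block_index_eq k) ?xl.
Qed.

(** The tail [0, b k] consists of the fixed point 0 and the blocks of index at least [k], each
    mapped into itself. *)
Lemma chain_map_itv k x : 0 <= x <= b k -> 0 <= F x <= b k.
Proof.
move=> /andP[x0 xk]; rewrite /F; case: ifP => xp; last by rewrite lexx ltW.
have /block_indexP : 0 < x <= 1 by rewrite xp (le_trans xk (b_le1 _)).
set l := block_index x => /andP[xl xh].
have /andP[Fl Fh] := block_map_itv l x.
rewrite (le_trans (ltW (b_gt0 _)) Fl)/= (le_trans Fh)// b_homo//.
rewrite leqNgt; apply/negP => /b_homo; rewrite leNgt; apply/negP/negPn.
exact: lt_le_trans xk.
Qed.

Lemma iter_chain_map_itv k j x : 0 <= x <= b k -> 0 <= iter j F x <= b k.
Proof. by elim: j => // j IH /IH /chain_map_itv. Qed.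

Lemma block_map_lip k x y : `|block_map k x - block_map k y| <= (s k)%:R * `|x - y|.
Proof.
have L0 := block_length_gt0 k; have -> : block_map k x - block_map k y =
    L k * (saw (s k) ((x - b k.+1) / L k) - saw (s k) ((y - b k.+1) / L k)).
  by rewrite /block_map; ring.
rewrite normrM gtr0_norm//; apply: le_trans (ler_wpM2l (ltW L0) (saw_lip _ _ _)) _.
have -> : (x - b k.+1) / L k - (y - b k.+1) / L k = (x - y) / L k by ring.
rewrite normrM normfV (gtr0_norm L0) mulrCA.
by rewrite [L k * _]mulrC mulfVK ?lexx ?lt0r_neq0.
Qed.

(** Blocks to the right of block [k] have smaller indices, hence by monotonicity of [t] no more
    branches: the slope on block [k] dominates. *)
Lemma chain_map_lip k x y : b k.+1 <= x <= b k -> x <= y <= 1 ->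
  `|F x - F y| <= (s k)%:R * `|x - y|.
Proof.
move=> xk /andP[xy y1]; have /andP[xl xh] := xk.
have x0 : 0 < x by exact: lt_le_trans xl.
rewrite (chain_map_block k) //.
have [yk|ky] := leP y (b k).
  by rewrite (chain_map_block k) ?block_map_lip// (le_trans xl xy).
have /block_indexP : 0 < y <= 1 by rewrite (lt_le_trans x0 xy).
set l := block_index y => /andP[yl yh].
have lk : (l < k)%N.
  rewrite ltnNge; apply/negP => /b_homo; rewrite leNgt => /negP; apply.
  exact: lt_le_trans ky yh.
rewrite (chain_map_block l); last by rewrite yh ltW.
(* Route the estimate through the fixed points [b k] and [b l.+1]; the gap between them keeps its
   length. *)
have h1 := block_map_lip k x (b k); have h2 := block_map_lip l (b l.+1) y.
rewrite block_map_top in h1; rewrite block_map_bot in h2.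
have h3 : b k <= b l.+1 := b_homo _ _ lk.
have sl : (s l)%:R <= (s k)%:R :> R.
  by rewrite ler_nat ltnS leq_double; apply: t_homo; exact: ltnW.
have s1 : 1 <= (s k)%:R :> R by rewrite ler1n.
have h4 : (s l)%:R * `|b l.+1 - y| <= (s k)%:R * `|b l.+1 - y|.
  exact: ler_wpM2r.
have h5 : `|b k - b l.+1| <= (s k)%:R * `|b k - b l.+1| by exact: ler_peMl.
have -> : `|x - y| = `|x - b k| + (`|b k - b l.+1| + `|b l.+1 - y|).
  rewrite !ler0_norm ?subr_le0 ?(ltW yl)//; ring.
rewrite !mulrDr; apply: le_trans (ler_distD (b k) _ _) _.
apply: lerD h1 _; apply: le_trans (ler_distD (b l.+1) _ _) _.
by apply: lerD h5 _; exact: le_trans h4.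
Qed.

(** At 0, continuity comes from the invariant tails; at [x > 0], from a Lipschitz bound on some
    [b k, 1] with [b k < x]. *)
Lemma chain_map_cont x e : 0 <= x <= 1 -> 0 < e ->
  exists2 d, 0 < d & forall y, 0 <= y <= 1 -> `|x - y| < d -> `|F x - F y| < e.
Proof.
move=> /andP[]; rewrite le_eqVlt => /orP[/eqP <- _|x0 x1] e0.
  have [k bk] := b_small _ e0; exists (b k) => // y /andP[y0 y1].
  rewrite sub0r normrN ger0_norm// => /ltW yk.
  have /andP[Fl Fh] : 0 <= F y <= b k by apply: chain_map_itv; rewrite y0.
  by rewrite {1}/F ltxx sub0r normrN ger0_norm// (le_lt_trans Fh).
have [k bk] := b_small _ x0.
have lip z z' : b k <= z -> z <= z' <= 1 -> `|F z - F z'| <= (s k)%:R * `|z - z'|.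
  move=> kz /andP[zz' z'1]; have z0 : 0 < z by exact: lt_le_trans kz.
  have /block_indexP : 0 < z <= 1 by rewrite z0 (le_trans zz').
  set l := block_index z => /andP[zl zh].
  have lk : (l <= k)%N.
    rewrite leqNgt; apply/negP => /b_homo lk.
    by have := b_dec k; lra.
  apply: (@le_trans _ _ ((s l)%:R * `|z - z'|)).
    by apply: chain_map_lip; rewrite ?zz'// zh ltW.
  by rewrite ler_wpM2r// ler_nat ltnS leq_double t_homo.
have sk0 : 0 < (s k)%:R :> R by rewrite ltr0n.
(* The first entry keeps [y] inside [b k, 1]. *)
exists (Num.min (x - b k) (e / (s k)%:R)).
  by rewrite lt_min subr_gt0 bk divr_gt0.
move=> y /andP[y0 y1]; rewrite lt_min => /andP[xy1 xy2].
have ky : b k <= y by move: xy1 => /ltr_normlW; lra.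
have sxy : (s k)%:R * `|x - y| < e by rewrite mulrC -ltr_pdivlMr.
apply: le_lt_trans sxy; have [xy|/ltW yx] := leP x y.
  by apply: lip; rewrite ?xy// ltW.
by rewrite distrC (distrC x); apply: lip; rewrite ?yx.
Qed.

Lemma iter_chain_map_block k j u : 0 <= u <= 1 ->
  iter j F (b k.+1 + L k * u) = b k.+1 + L k * iter j (saw (s k)) u.
Proof.
move=> u01; elim: j => //= j ->; set v := iter j _ u.
have /andP[v0 v1] : 0 <= v <= 1 by exact: iter_saw_itv.
rewrite (chain_map_block k); last first.
  rewrite lerDl mulr_ge0//=; last exact/ltW/block_length_gt0.
  by rewrite -lerBrDl ler_piMr//; exact/ltW/block_length_gt0.
by rewrite /block_map addrAC subrr add0r mulrAC divff ?mul1r// gt_eqF ?block_length_gt0.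
Qed.

Lemma block_coord_itv k x : b k.+1 <= x <= b k -> 0 <= (x - b k.+1) / L k <= 1.
Proof.
move=> /andP[xl xh]; apply/andP; split.
  by apply: divr_ge0; [rewrite subr_ge0|exact/ltW/block_length_gt0].
by rewrite ler_pdivrMr ?block_length_gt0// mul1r lerD2r.
Qed.

Lemma block_coordK k x : b k.+1 + L k * ((x - b k.+1) / L k) = x.
Proof. by rewrite mulrC mulfVK ?lt0r_neq0 ?block_length_gt0// addrC subrK. Qed.

(* Points of the invariant tail [[0, b K]] are coded by cells of length [e];
   a point of an earlier block is coded by its block and by the linearity
   pieces of the sawtooth that its orbit visits. *)
Definition orbit_code e K N M x : 'I_K.+1 * {ffun 'I_N -> 'I_M.+1} :=
  if x <= b K then (ord_max, [ffun i : 'I_N => inord (Num.truncn (iter i F x / e))])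
  else let k := block_index x in
    (inord k, [ffun i : 'I_N => inord (Num.truncn
      ((s k)%:R * iter i (saw (s k)) ((x - b k.+1) / L k)))]).

Lemma block_index_lt K x : b K < x <= 1 -> (block_index x < K)%N.
Proof.
move=> /andP[Kx x1]; have /block_indexP/andP[xl xh] : 0 < x <= 1.
  by rewrite (lt_trans _ Kx).
by rewrite ltnNge; apply/negP => /b_homo; rewrite leNgt (lt_le_trans Kx xh).
Qed.

(** Codes of length [n + m] control [n] times: on a block, the [m] further common branches bound the
    distance at time [j] by [1 / 3 ^ m], at most [e]; on the tail, equal cells at time [j]
    suffice. *)
Lemma orbit_code_close e K n m M x y j : 0 < e -> 1 <= e * 3 ^+ m ->
  b K <= e * M%:R -> (forall k, (k < K)%N -> (s k <= M)%N) ->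
  0 <= x <= 1 -> 0 <= y <= 1 ->
  orbit_code e K (n + m) M x = orbit_code e K (n + m) M y -> (j < n)%N ->
  `|iter j F x - iter j F y| <= e.
Proof.
move=> e0 em bM sM /andP[x0 x1] /andP[y0 y1] + jn; rewrite /orbit_code.
have jnm : (j < n + m)%N by rewrite ltn_addr.
have lt_ordK k : (k < K)%N -> ord_max <> inord k :> 'I_K.+1.
  move=> kK /(congr1 val) /=; rewrite inordK; last exact: ltnW.
  by move=> Kk; rewrite Kk ltnn in kK.
have [xK|Kx] := leP x (b K); have [yK|Ky] := leP y (b K).
- move=> [/ffunP/(_ (Ordinal jnm))]; rewrite !ffunE /= => xy.
  have cell (z : R) : 0 <= z <= b K -> 0 <= iter j F z / e <= M%:R.
    move=> /(iter_chain_map_itv _ j)/andP[z0 zK]; rewrite divr_ge0 ?(ltW e0)//=.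
    by rewrite ler_pdivrMr// (le_trans zK)// mulrC.
  have cx := cell x; have cy := cell y; rewrite x0 xK in cx; rewrite y0 yK in cy.
  have /andP[cx0 _] := cx isT; have /andP[cy0 _] := cy isT.
  have := truncn_eq_lt1 _ _ cx0 cy0 (inord_truncn_inj _ _ _ (cx isT) (cy isT) xy).
  rewrite -mulrBl normrM normfV (gtr0_norm e0) ltr_pdivrMr// mul1r; exact: ltW.
- by move=> [/lt_ordK[]]; apply: block_index_lt; rewrite Ky.
- by move=> [/esym/lt_ordK[]]; apply: block_index_lt; rewrite Kx.
have kxK : (block_index x < K)%N by apply: block_index_lt; rewrite Kx.
have kyK : (block_index y < K)%N by apply: block_index_lt; rewrite Ky.
move=> [kE].
have {}kE : block_index x = block_index y.
  by move: (congr1 (@nat_of_ord _) kE); rewrite !inordK ?ltnS ?(ltnW kxK) ?(ltnW kyK).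
rewrite -kE; set k := block_index x in kxK kE * => itin.
have /block_indexP : 0 < x <= 1 by rewrite (lt_trans _ Kx).
have /block_indexP : 0 < y <= 1 by rewrite (lt_trans _ Ky).
rewrite -kE -/k => /andP[/ltW yl yh] /andP[/ltW xl xh].
have u01 : 0 <= (x - b k.+1) / L k <= 1 by apply: block_coord_itv; rewrite xl.
have v01 : 0 <= (y - b k.+1) / L k <= 1 by apply: block_coord_itv; rewrite yl.
rewrite -[x](block_coordK k) -[y](block_coordK k) !iter_chain_map_block//.
set u := _ / _ in u01 itin *; set v := _ / _ in v01 itin *.
have uj := iter_saw_itv (s k) j _ u01; have vj := iter_saw_itv (s k) j _ v01.
have sep : (s k)%:R ^+ m * `|iter j (saw (s k)) u - iter j (saw (s k)) v| <= 1.
  apply: same_itinerary_near => // i im.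
  have ijnm : (i + j < n + m)%N by rewrite addnC -addnS leq_add// ltnW.
  move/ffunP/(_ (Ordinal ijnm)) : itin; rewrite !ffunE /= !iterD.
  have cell (w : R) : 0 <= w <= 1 -> 0 <= (s k)%:R * iter i (saw (s k)) w <= M%:R.
    move=> /(iter_saw_itv (s k) i)/andP[w0 w1]; rewrite mulr_ge0//=.
    rewrite (le_trans (ler_piMr _ w1))// ler_nat; exact: sM.
  by apply: inord_truncn_inj; exact: cell.
set d := `|_ - _| in sep; have s3 : 3 <= (s k)%:R :> R.
  by rewrite ler_nat ltnS (leq_double 1) t_gt0.
have de : d <= e.
  rewrite -(ler_pM2l (x := (s k)%:R ^+ m)) ?exprn_gt0 ?ltr0n//.
  apply: (le_trans sep); apply: (le_trans em); rewrite mulrC ler_pM2r//.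
  by apply: lerXn2r; rewrite ?nnegrE.
rewrite [_ - _](_ : _ = L k * (iter j (saw (s k)) u - iter j (saw (s k)) v)).
  by rewrite normrM gtr0_norm ?block_length_gt0// (le_trans _ de)// ler_piMl ?block_length_le1.
by ring.
Qed.

(** * Transport to a metric space along a Lipschitz retraction *)

Section Lift.
Context {X : metricType R}.
Variables (h : R -> X) (p : X -> R) (C : R).
Hypothesis C_ge1 : 1 <= C.
Hypothesis p_itv : forall x : X, 0 <= p x <= 1.
Hypothesis hK : forall u, 0 <= u <= 1 -> p (h u) = u.
Hypothesis h_lip : forall u v, 0 <= u <= 1 -> 0 <= v <= 1 ->
  mdist (h u) (h v) <= C * `|u - v|.
Hypothesis p_lip : forall x y : X, `|p x - p y| <= C * mdist x y.
Hypothesis X_tot_bounded : forall e, 0 < e ->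
  exists N (c : X -> 'I_N), forall x y : X, c x = c y -> mdist x y <= e.

(** By [hK], composing [p] with [h] retracts [X] onto an embedded interval carrying a copy of [F];
    every orbit is there after one step. *)
Definition lift_map (x : X) : X := h (F (p x)).

Let C_gt0 : 0 < C. Proof. exact: lt_le_trans C_ge1. Qed.

Lemma iter_chain_map_01 j u : 0 <= u <= 1 -> 0 <= iter j F u <= 1.
Proof. by have := @iter_chain_map_itv 0%N j u; rewrite b0. Qed.

Lemma iter_lift_map j (x : X) : iter j.+1 lift_map x = h (iter j.+1 F (p x)).
Proof.
elim: j => // j IH; rewrite iterS IH {1}/lift_map hK//.
exact: iter_chain_map_01.
Qed.

Lemma iter_lift_map_section j u : 0 <= u <= 1 ->
  iter j lift_map (h u) = h (iter j F u).
Proof. by case: j => // j u01; rewrite iter_lift_map hK. Qed.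

Lemma lift_map_continuous : continuous lift_map.
Proof.
move=> x; apply/metricType_numDomainType.cvgrPdist_lt => e e0.
have [d d0 dP] := chain_map_cont _ _ (p_itv x) (divr_gt0 e0 C_gt0).
have := nbhsx_ballx x (d / C) (divr_gt0 d0 C_gt0).
apply: filterS => y; rewrite ballEmdist /= ltr_pdivlMr// => xy.
have xyd : `|p x - p y| < d by apply: le_lt_trans (p_lip x y) _; rewrite mulrC.
have := dP _ (p_itv y) xyd; rewrite ltr_pdivlMr// mulrC; apply: le_lt_trans.
by apply: h_lip; exact: (iter_chain_map_01 1).
Qed.

(** A code is a cell of [X], for time 0 when [x] may be off the embedded interval, plus an orbit
    code of [p x] at scale [eps / C]. There are [N * K.+1 * M.+1 ^ (n + m)] codes, so only [M.+1]
    survives in the rate. *)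
Lemma lift_rate_le eps K M : 0 < eps -> C * b K <= eps * M%:R ->
  (forall k, (k < K)%N -> (s k <= M)%N) ->
  (sep_rate lift_map eps <= (ln M.+1%:R)%:E)%E.
Proof.
move=> eps0 bM sM; have e0 : 0 < eps / C by rewrite divr_gt0.
have [N [c cP]] := X_tot_bounded _ eps0.
have N0 : (0 < N)%N by case: (c (h 0)) => i; exact: leq_trans.
have [m em] : exists m, 1 <= eps / C * 3 ^+ m.
  (* It suffices that [3 ^ m >= C / eps], and [q < 3 ^ q] provides such an [m]. *)
  exists (Num.truncn (eps / C)^-1).+1; rewrite -ler_pdivrMl// mulr1.
  apply: le_trans (ltW (truncnS_gt _)) _; rewrite -natrX ler_nat ltnW//.
  exact: ltn_expl.
apply: (@sep_rate_le _ _ _ _ _ (N%:R * (K.+1%:R * M.+1%:R ^+ m))).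
- by rewrite ltr0n.
- by rewrite !mulr_gt0 ?exprn_gt0 ?ltr0n.
move=> n; pose cc (x : X) := (c x, orbit_code (eps / C) K (n + m) M (p x)).
have := @sep_card_le _ _ lift_map n eps _ cc.
rewrite !card_prod !card_ord card_ffun !card_ord expnD !natrM !natrX.
rewrite [_ ^+ n * _]mulrC !mulrA; apply=> x y [cxy oxy].
apply: bowen_dist_le => [|j jn]; first exact: ltW.
case: j => [|j] in jn *; first exact: cP.
rewrite !iter_lift_map; apply: le_trans (h_lip _ _ _ _) _.
- exact: iter_chain_map_01.
- exact: iter_chain_map_01.
rewrite mulrC -ler_pdivlMr//.
apply: (orbit_code_close _ _ _ _ _ _ _ _ e0 em _ sM _ _ oxy jn) => //.
by rewrite mulrAC ler_pdivlMr// mulrC.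
Qed.

(** The words of length [n] in [(t k).+1] letters give coded points of block [k]. Their gap
    [1 / s k] becomes [L k / s k] in the block, and at least [L k / (C * s k)] in [X] by [p_lip]. *)
Lemma lift_rate_ge eps k : 0 < eps -> eps * (C * (s k)%:R) < L k ->
  ((ln (t k).+1%:R)%:E <= sep_rate lift_map eps)%E.
Proof.
move=> eps0 epsk; apply: sep_rate_ge; first by rewrite ltr0n.
move=> n; pose f (w : n.-tuple 'I_(t k).+1) : X :=
  h (b k.+1 + L k * coded_point (t k) (map val w)).
have := @sep_card_ge _ _ lift_map n eps _ f (ltW eps0).
rewrite card_tuple card_ord natrX; apply=> u v uv.
have le_t (w : n.-tuple 'I_(t k).+1) : all (leq^~ (t k)) (map val w).
  by apply/allP => _ /mapP[i _ ->]; rewrite -ltnS ltn_ord.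
have in01 (y : R) : 0 <= y <= 1 -> 0 <= b k.+1 + L k * y <= 1.
  move=> /andP[y0 y1]; rewrite addr_ge0 ?mulr_ge0 ?(ltW (b_gt0 _)) ?(ltW (block_length_gt0 _))//=.
  apply: le_trans (b_le1 k); rewrite -lerBrDl ler_piMr//; exact/ltW/block_length_gt0.
have [||j] := @coded_point_sep R (t k) _ _ (le_t u) (le_t v).
- by rewrite !size_map !size_tuple.
- by apply: contraNneq uv => /(inj_map val_inj)/val_inj ->.
rewrite size_map size_tuple -/(s k) => jn jsep.
apply: lt_le_trans (bowen_dist_ge _ _ _ _ _ jn).
have cu := coded_point_itv _ _ (le_t u); have cv := coded_point_itv _ _ (le_t v).
rewrite /f !iter_lift_map_section ?in01// !iter_chain_map_block//.
set y := iter j _ _ in jsep *; set z := iter j _ (coded_point _ (map val v)) in jsep *.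
have y01 : 0 <= y <= 1 by exact: iter_saw_itv.
have z01 : 0 <= z <= 1 by exact: iter_saw_itv.
have := p_lip (h (b k.+1 + L k * y)) (h (b k.+1 + L k * z)).
rewrite !hK ?in01//.
have -> : b k.+1 + L k * y - (b k.+1 + L k * z) = L k * (y - z) by ring.
rewrite normrM gtr0_norm ?block_length_gt0// => yz.
rewrite -(ltr_pM2l C_gt0); apply: lt_le_trans yz.
apply: (@lt_le_trans _ _ (L k / (s k)%:R)).
  by rewrite ltr_pdivlMr ?ltr0n// (mulrC C) -mulrA.
by rewrite ler_pM2l ?block_length_gt0.
Qed.

End Lift.

End ChainOfHorseshoes.

(** * Metric mean dimension from separation rates *)

Section MdimFromRates.
Context {R : realType} {X : metricType R}.
Variables (phi : X -> X) (a D E : R).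
Hypotheses (a_itv : 0 <= a <= 1) (E_gt0 : 0 < E).
Hypothesis rate_le : forall eps, 0 < eps < 1 ->
  (sep_rate phi eps <= (a * - ln eps + D)%:E)%E.
Hypothesis rate_ge : forall eps (k : nat), 0 < eps ->
  eps * (E * k.+2%:R ^+ 2 * expR k%:R) < 1 -> ((a * k%:R)%:E <= sep_rate phi eps)%E.

Lemma near_ln_gt (T : R) : \forall eps \near (0 : R)^'+, T < - ln eps.
Proof.
near=> eps; have eps0 : 0 < eps by near: eps; exact: nbhs_right_gt.
have : eps < expR (- T) by near: eps; apply: nbhs_right_lt; exact: expR_gt0.
by rewrite -ltr_ln ?posrE ?expR_gt0// expRK; lra.
Unshelve. all: by end_near. Qed.

Lemma upper_mdim_le : (upper_mdim phi <= a%:E)%E.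
Proof.
apply/lee_addgt0Pr => e e0; apply: limf_esup_le_near; near=> eps.
have eps0 : 0 < eps by near: eps; exact: nbhs_right_gt.
have eps1 : eps < 1 by near: eps; exact: nbhs_right_lt.
have t0 : 0 < - ln eps by near: eps; exact: near_ln_gt.
have tD : D / e < - ln eps by near: eps; exact: near_ln_gt.
rewrite ltr0_norm -?oppr_gt0// lee_pdivrMr// -EFinD -EFinM.
apply: le_trans (rate_le _ _) _; first by rewrite eps0.
by rewrite lee_fin mulrDl lerD2l mulrC -ler_pdivrMr// ltW.
Unshelve. all: by end_near. Qed.

(** Cubing [1 + x <= exp x] at [x = d * T / 3], with [2 * d / 3 <= 1], bounds [exp (d * T)] below by
    [(d * (T + 2) / 3) ^ 3], a cubic that beats the square for such [T]. *)
Lemma expR_gt_square (d T : R) : 0 < d <= 1 -> 0 <= T -> E * (3 / d) ^+ 3 < T ->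
  E * (T + 2) ^+ 2 < expR (d * T).
Proof.
move=> /andP[d0 d1] T0 ET; have q0 : 0 < d / 3 * (T + 2) by rewrite !mulr_gt0; lra.
have h : d / 3 * (T + 2) <= expR (d * T / 3).
  by apply: le_trans (expR_ge1Dx _); lra.
have -> : d * T = d * T / 3 * 3 by rewrite mulfVK.
rewrite expRM_natr; apply: lt_le_trans (lerXn2r 3 _ _ h); rewrite ?nnegrE ?expR_ge0 ?(ltW q0)//.
have -> : (d / 3 * (T + 2)) ^+ 3 = (d / 3) ^+ 3 * (T + 2) * (T + 2) ^+ 2 by ring.
rewrite ltr_pM2r ?exprn_gt0//; last by lra.
have : E < (d / 3) ^+ 3 * T.
  by rewrite mulrC -ltr_pdivrMr ?exprn_gt0 ?divr_gt0// -exprVn invf_div.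
have : 0 < (d / 3) ^+ 3 by rewrite exprn_gt0 ?divr_gt0.
lra.
Qed.

(** At scale [eps = exp (- T)] take for [k] the integer part of [(1 - d) * T]. The spare factor
    [exp (- d * T)] absorbs the polynomial in [rate_ge], while [a * k] falls short of [a * T] by at
    most [a * d * T + a], below [e * T]. *)
Lemma lower_mdim_ge : (a%:E <= lower_mdim phi)%E.
Proof.
apply/lee_subgt0Pr => e e0; apply: limf_einf_ge_near; near=> eps.
pose d := Num.min (e / 2) 1.
have d01 : 0 < d <= 1 by rewrite lt_min ge_min lexx orbT divr_gt0 ?ltr01.
have /andP[d0 d1] := d01; have /andP[a0 a1] := a_itv.
have de : d <= e / 2 by rewrite ge_min lexx.
have eps0 : 0 < eps by near: eps; exact: nbhs_right_gt.
have t0 : 0 < - ln eps by near: eps; exact: near_ln_gt.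
have te : 2 / e < - ln eps by near: eps; exact: near_ln_gt.
have tE : E * (3 / d) ^+ 3 < - ln eps by near: eps; exact: near_ln_gt.
rewrite ltr0_norm -?oppr_gt0// lee_pdivlMr// -EFinB -EFinM.
move: t0 te tE; set T := - ln eps => t0 te tE.
have epsE : eps = expR (- T) by rewrite opprK lnK.
have dT0 : 0 <= (1 - d) * T by apply: mulr_ge0; [lra|exact: ltW].
have /andP[kl kh] := truncn_itv dT0; set k := Num.truncn _ in kl kh.
apply: le_trans (rate_ge _ k eps0 _).
  rewrite lee_fin; rewrite ltr_pdivrMr// in te; rewrite -natr1 in kh.
  have aT : a * ((1 - d) * T - 1) <= a * k%:R by apply: ler_wpM2l; lra.
  have adT : a * (d * T) <= d * T by rewrite ler_piMl ?mulr_ge0 ?(ltW d0) ?(ltW t0).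
  have dT : d * T <= e / 2 * T by rewrite ler_pM2r.
  by lra.
apply: (@le_lt_trans _ _ (E * (T + 2) ^+ 2 * expR (- (d * T)))); last first.
  by rewrite expRN -ltr_pdivlMr ?invr_gt0 ?expR_gt0// mul1r invrK expR_gt_square// ltW.
have kT : k.+2%:R <= T + 2 :> R.
  rewrite -addn2 natrD lerD2r; apply: le_trans kl _.
  by rewrite ler_piMl ?(ltW t0)//; lra.
rewrite [leLHS](_ : _ = E * k.+2%:R ^+ 2 * (eps * expR k%:R)); last by ring.
apply: ler_pM.
- by rewrite mulr_ge0 ?exprn_ge0 ?(ltW E_gt0).
- by rewrite mulr_ge0 ?expR_ge0 ?(ltW eps0).
- by rewrite ler_pM2l// lerXn2r ?nnegrE//; lra.
by rewrite epsE -expRD ler_expR; lra.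
Unshelve. all: by end_near. Qed.

Lemma mdim_eq : lower_mdim phi = a%:E /\ upper_mdim phi = a%:E.
Proof.
have le : (lower_mdim phi <= upper_mdim phi)%E by exact: limf_einf_le_esup.
split; apply/eqP; rewrite eq_le.
  by rewrite lower_mdim_ge andbT (le_trans le upper_mdim_le).
by rewrite upper_mdim_le (le_trans lower_mdim_ge le).
Qed.

End MdimFromRates.

(** * The exponential choice of endpoints and branch numbers *)

Section ExponentialChain.
Context {R : realType}.
Variable a : R.
Hypothesis a_itv : 0 <= a <= 1.
Implicit Types k l : nat.

(** The factor [1 / k.+1] forces convergence to 0 even for [a = 1], at the price of a polynomial
    factor in the block lengths. *)
Definition endpoint k : R := expR (- ((1 - a) * k%:R)) / k.+1%:R.

Definition letters k : nat := Num.truncn (expR (a * k%:R)).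

Lemma endpoint0 : endpoint 0%N = 1.
Proof. by rewrite /endpoint mulr0 oppr0 expR0 divr1. Qed.

Lemma endpoint_gt0 k : 0 < endpoint k.
Proof. by rewrite divr_gt0 ?expR_gt0. Qed.

Lemma endpoint_le k : endpoint k <= expR (- ((1 - a) * k%:R)).
Proof. by rewrite ler_pdivrMr// ler_peMr ?expR_ge0// ler1n. Qed.

(** Replace the exponential in [endpoint k.+1] by the larger one at [k]; what remains is
    [1 / k.+1 - 1 / k.+2 = 1 / (k.+1 * k.+2)]. *)
Lemma endpoint_gap k : expR (- ((1 - a) * k%:R)) / k.+2%:R ^+ 2 <=
  endpoint k - endpoint k.+1.
Proof.
have /andP[a0 a1] := a_itv.
have h : endpoint k.+1 <= expR (- ((1 - a) * k%:R)) / k.+2%:R.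
  by rewrite ler_pM2r ?invr_gt0// ler_expR lerN2 ler_wpM2l ?ler_nat//; lra.
apply: le_trans (lerB (lexx _) h); rewrite /endpoint -mulrBr ler_pM2l ?expR_gt0//.
have k1 : 0 < k.+1%:R :> R by [].
have -> : k.+2%:R = k.+1%:R + 1 :> R by rewrite -natr1.
have -> : k.+1%:R^-1 - (k.+1%:R + 1)^-1 = (k.+1%:R * (k.+1%:R + 1))^-1 :> R.
  by field; rewrite !lt0r_neq0//; lra.
rewrite lef_pV2 ?posrE ?mulr_gt0 ?exprn_gt0//; lra.
Qed.

Lemma endpoint_dec k : endpoint k.+1 < endpoint k.
Proof.
rewrite -subr_gt0; apply: lt_le_trans (endpoint_gap k).
by rewrite divr_gt0 ?expR_gt0 ?exprn_gt0.
Qed.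

Lemma endpoint_small (x : R) : 0 < x -> exists k, endpoint k < x.
Proof.
move=> x0; have /andP[a0 a1] := a_itv; exists (Num.truncn x^-1).
rewrite /endpoint ltr_pdivrMr//; apply: (@le_lt_trans _ _ 1).
  by rewrite -[leRHS]expR0 ler_expR oppr_le0 mulr_ge0 ?subr_ge0.
by rewrite mulrC -ltr_pdivrMr// mul1r truncnS_gt.
Qed.

Lemma letters_homo : {homo letters : k l / (k <= l)%N}.
Proof.
move=> k l kl; have /andP[a0 a1] := a_itv.
by apply: le_truncn; rewrite ler_expR ler_wpM2l// ler_nat.
Qed.

Lemma letters_gt0 k : (0 < letters k)%N.
Proof.
have /andP[a0 a1] := a_itv.
by rewrite truncn_gt0 -[leLHS]expR0 ler_expR mulr_ge0.
Qed.

Lemma branches_le k : (letters k).*2.+1%:R <= 3 * expR (a * k%:R) :> R.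
Proof.
have /andP[a0 a1] := a_itv.
have := expR_ge0 (a * k%:R); rewrite -truncn_le natr_doubleS -/(letters k) => h.
have : 1 <= expR (a * k%:R) by rewrite -[leLHS]expR0 ler_expR mulr_ge0.
lra.
Qed.

Lemma exists_map_mdim_eq {X : metricType R} (h : R -> X) (p : X -> R) (C : R) :
  1 <= C ->
  (forall x, 0 <= p x <= 1) ->
  (forall u, 0 <= u <= 1 -> p (h u) = u) ->
  (forall u v, 0 <= u <= 1 -> 0 <= v <= 1 -> mdist (h u) (h v) <= C * `|u - v|) ->
  (forall x y, `|p x - p y| <= C * mdist x y) ->
  (forall e, 0 < e -> exists N (c : X -> 'I_N),
    forall x y, c x = c y -> mdist x y <= e) ->
  exists phi : X -> X,
    [/\ continuous phi, lower_mdim phi = a%:E & upper_mdim phi = a%:E].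
Proof.
move=> C1 p01 hK h_lip p_lip X_tb; have C0 : 0 < C by exact: lt_le_trans C1.
have /andP[a0 a1] := a_itv; have e_ge1 k : 1 <= expR (a * k%:R) :> R.
  by rewrite -[leLHS]expR0 ler_expR mulr_ge0.
pose phi := lift_map endpoint letters h p; exists phi.
suff [lo up] : lower_mdim phi = a%:E /\ upper_mdim phi = a%:E.
  split=> //; exact: (lift_map_continuous _ _ endpoint0 endpoint_gt0 endpoint_dec
    endpoint_small letters_homo _ _ _ C1 p01 h_lip p_lip).
(* [3 * C] comes from [s k <= 3 * exp (a * k)] in the lower bound, [a + ln (C + 5)] from
   [M.+1 <= (C + 5) * exp (a * K)] and [K <= T + 1] in the upper one. *)
apply: (@mdim_eq _ _ phi a (a + ln (C + 5)) (3 * C)) => //.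
- by rewrite mulr_gt0.
- move=> eps /andP[eps0 eps1]; set T := - ln eps.
  have T0 : 0 < T by rewrite oppr_gt0 ln_lt0// eps0.
  have epsE : eps = expR (- T) by rewrite opprK lnK.
  have /andP[Kl Kh] := truncn_itv (ltW T0); set K := (Num.truncn T).+1 in Kh.
  pose e := expR (a * K%:R); have e1 : 1 <= e by exact: e_ge1.
  have Ce0 : 0 <= (C + 3) * e by rewrite mulr_ge0//; lra.
  (* One alphabet serves both needs: [C * e] cells for the tail and [3 * e] branches for the
     blocks. *)
  set M := (Num.truncn ((C + 3) * e)).+1.
  have Ml : (C + 3) * e < M%:R by exact: truncnS_gt.
  have Mh : M%:R <= (C + 3) * e + 1 by rewrite /M -natr1 lerD2r truncn_le.
  apply: (@le_trans _ _ (ln M.+1%:R)%:E).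
    apply: (lift_rate_le _ _ endpoint0 endpoint_gt0 endpoint_dec endpoint_small
      letters_gt0 _ _ _ C1 p01 hK h_lip X_tb _ K) => //.
      apply: (@le_trans _ _ (C * expR (- ((1 - a) * K%:R)))).
        by rewrite ler_pM2l// endpoint_le.
      (* As [e = exp (a * K)], the tail bound factors this way, and [K > T] puts [exp (- K)] below
         [eps]. *)
      apply: (@le_trans _ _ (expR (- K%:R) * (C * e))).
        by rewrite mulrCA ler_pM2l// -expRD ler_expR; lra.
      apply: ler_pM; rewrite ?expR_ge0 ?mulr_ge0 ?expR_ge0 ?(ltW C0)//.
        by rewrite epsE ler_expR; lra.
      by apply: le_trans (ltW Ml); rewrite ler_pM2r; lra.
    move=> k kK; rewrite -(ler_nat R); apply: le_trans (branches_le k) _.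
    have ek : expR (a * k%:R) <= e.
      by rewrite ler_expR ler_wpM2l// ler_nat ltnW.
    by apply: le_trans (ltW Ml); rewrite ler_pM ?expR_ge0//; lra.
  rewrite lee_fin; apply: (@le_trans _ _ (ln ((C + 5) * e))).
    by rewrite ler_ln ?posrE ?ltr0n//; [rewrite -natr1; lra|rewrite mulr_gt0; lra].
  rewrite lnM ?posrE ?expR_gt0//; last by lra.
  rewrite expRK.
  have : a * K%:R <= a * (T + 1) by rewrite ler_wpM2l// /K -natr1 lerD2r.
  by lra.
- move=> eps k eps0 epsk; apply: (@le_trans _ _ (ln (letters k).+1%:R)%:E).
    by rewrite lee_fin -[leLHS]expRK ler_ln ?posrE ?expR_gt0// ltW// truncnS_gt.
  apply: (lift_rate_ge _ _ endpoint0 endpoint_gt0 endpoint_dec endpoint_small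
      _ _ _ C1 p01 hK p_lip) => //=.
  apply: lt_le_trans (endpoint_gap k); rewrite ltr_pdivlMr ?exprn_gt0//.
  rewrite expRN -[ltRHS]mul1r ltr_pdivlMr ?expR_gt0//; apply: le_lt_trans epsk.
  (* The first factor accounts for the number of branches, the second for the length of the block in
     [endpoint_gap]. *)
  have -> : expR k%:R = expR (a * k%:R) * expR ((1 - a) * k%:R).
    by rewrite -expRD; congr expR; ring.
  rewrite [leRHS](_ : _ = eps * (C * (3 * expR (a * k%:R))) * k.+2%:R ^+ 2 *
    expR ((1 - a) * k%:R)); last by ring.
  by rewrite ler_pM2r ?expR_gt0// ler_pM2r ?exprn_gt0// ler_pM2l// ler_pM2l// branches_le.
Qed.

End ExponentialChain.

(** * The interval and the circle *)

Section Spaces.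
Context {R : realType}.

Lemma cells_of_unit_valued {X : Type} (f : X -> R) (e : R) : 0 < e ->
  (forall x, 0 <= f x <= 1) ->
  exists N (c : X -> 'I_N), forall x y, c x = c y -> `|f x - f y| <= e.
Proof.
move=> e0 f01; pose M := (Num.truncn e^-1).+1; exists M.+1.
exists (fun x => inord (Num.truncn (f x / e))) => x y cxy.
have cell z : 0 <= f z / e <= M%:R.
  have /andP[f0 f1] := f01 z; rewrite divr_ge0 ?(ltW e0)//=.
  apply: le_trans (ltW (truncnS_gt _)).
  by rewrite ler_piMl ?invr_ge0 ?(ltW e0).
have /andP[x0 _] := cell x; have /andP[y0 _] := cell y.
have := truncn_eq_lt1 _ _ x0 y0 (inord_truncn_inj _ _ _ (cell x) (cell y) cxy).
by rewrite -mulrBl normrM normfV (gtr0_norm e0) ltr_pdivrMr// mul1r => /ltW.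
Qed.

Let I := unit_interval R.

Lemma interval_map_mdim_eq (a : R) : 0 <= a <= 1 ->
  exists phi : I -> I,
    [/\ continuous phi, lower_mdim phi = a%:E & upper_mdim phi = a%:E].
Proof.
move=> a01; have zero01 : 0 <= (0 : R) <= 1 by apply/andP.
pose h (u : R) : I := insubd (exist _ 0 zero01 : I) u.
have valh u : 0 <= u <= 1 -> val (h u) = u by move=> u01; rewrite insubdK.
have val01 (x : I) : 0 <= val x <= 1 by exact: (valP x).
apply: (exists_map_mdim_eq _ a01 h (fun x => val x) 1) => //.
- move=> u v u01 v01; rewrite mul1r.
  have -> : mdist (h u) (h v) = `|val (h u) - val (h v)| by [].
  by rewrite !valh.
- by move=> x y; rewrite mul1r.
- by move=> e e0; exact: cells_of_unit_valued e0 val01.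
Qed.

Let S := circle R.

Lemma circle_distE (p q : S) : mdist p q =
  Num.sqrt (((val p).1 - (val q).1) ^+ 2 + ((val p).2 - (val q).2) ^+ 2).
Proof. by []. Qed.

Lemma circle_abs_le1 (p : S) : `|(val p).1| <= 1 /\ `|(val p).2| <= 1.
Proof.
have /eqP := valP p; set x := (val p).1; set y := (val p).2 => xy.
have x2 := sqr_ge0 x; have y2 := sqr_ge0 y.
have le1 (z : R) : z ^+ 2 <= 1 -> `|z| <= 1.
  by rewrite -real_normK ?num_real// expr_le1.
by split; apply: le1; lra.
Qed.

Lemma circle_coord_le (p q : S) : `|(val p).1 - (val q).1| <= mdist p q /\
  `|(val p).2 - (val q).2| <= mdist p q.
Proof.
by rewrite circle_distE -!sqrtr_sqr !ler_sqrt ?addr_ge0 ?sqr_ge0//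
  lerDl lerDr !sqr_ge0.
Qed.

Lemma circle_dist_le (p q : S) :
  mdist p q <= `|(val p).1 - (val q).1| + `|(val p).2 - (val q).2|.
Proof.
rewrite circle_distE; set x := _ - _; set y := (val p).2 - _.
rewrite -[leRHS]ger0_norm ?addr_ge0// -[leRHS]sqrtr_sqr ler_sqrt ?sqr_ge0//.
rewrite [leRHS]sqrrD !real_normK ?num_real// addrAC lerDl.
by rewrite mulrn_wge0// mulr_ge0.
Qed.

(* Stereographic parametrisation of the first quadrant. *)
Definition arc_pair (u : R) : R * R := ((1 - u ^+ 2) / (1 + u ^+ 2), 2 * u / (1 + u ^+ 2)).

Lemma arc_pairP u : (arc_pair u).1 ^+ 2 + (arc_pair u).2 ^+ 2 == 1.
Proof.
have u2 := sqr_ge0 u; apply/eqP; rewrite /arc_pair /=; field.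
by apply: lt0r_neq0; lra.
Qed.

Definition arc (u : R) : S := exist _ (arc_pair u) (arc_pairP u).

(** The absolute values fold the circle onto the first quadrant, where this is the inverse of the
    parametrisation. *)
Definition arc_coord (p : S) : R := `|(val p).2| / (1 + `|(val p).1|).

Lemma arc_coord_itv p : 0 <= arc_coord p <= 1.
Proof.
have [_ y1] := circle_abs_le1 p; rewrite divr_ge0 ?addr_ge0//=.
by rewrite ler_pdivrMr ?ltr_pwDl// mul1r (le_trans y1)// lerDl.
Qed.

Lemma arcK u : 0 <= u <= 1 -> arc_coord (arc u) = u.
Proof.
move=> /andP[u0 u1]; have u2 := sqr_ge0 u; have u21 : u ^+ 2 <= 1 by rewrite expr_le1.
rewrite /arc_coord /arc_pair /= !ger0_norm ?divr_ge0 ?mulr_ge0 ?subr_ge0 ?addr_ge0//.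
by field; rewrite !lt0r_neq0//; lra.
Qed.

(** The squared chord is exactly [4 * (u - v) ^ 2 / ((1 + u ^ 2) * (1 + v ^ 2))]. *)
Lemma arc_lip u v : mdist (arc u) (arc v) <= 2 * `|u - v|.
Proof.
have u2 := sqr_ge0 u; have v2 := sqr_ge0 v.
have u0 : 0 < 1 + u ^+ 2 by lra.
have v0 : 0 < 1 + v ^+ 2 by lra.
rewrite circle_distE /= -[leRHS]ger0_norm ?mulr_ge0// -sqrtr_sqr ler_sqrt ?sqr_ge0//.
rewrite [leLHS](_ : _ = 4 * (u - v) ^+ 2 / ((1 + u ^+ 2) * (1 + v ^+ 2))); last first.
  by field; rewrite !lt0r_neq0.
rewrite exprMn real_normK ?num_real// ler_pdivrMr ?mulr_gt0//.
rewrite -natrX; apply: ler_peMr; first by rewrite mulr_ge0// sqr_ge0.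
by rewrite mulr_ege1// lerDl.
Qed.

Lemma arc_coord_lip p q : `|arc_coord p - arc_coord q| <= 2 * mdist p q.
Proof.
have [dx dy] := circle_coord_le p q; have [_ y1] := circle_abs_le1 q.
rewrite /arc_coord.
have hx := le_trans (ler_dist_dist (val p).1 (val q).1) dx.
have hy := le_trans (ler_dist_dist (val p).2 (val q).2) dy.
move: hx hy y1; set A := `|(val p).2|; set B := `|(val q).2|.
set c := `|(val p).1|; set d := `|(val q).1|; set D := mdist p q.
have c0 : 0 <= c := normr_ge0 _; have d0 : 0 <= d := normr_ge0 _.
move=> cd AB B1.
(* Vary numerator and denominator separately: as [B <= 1] and denominators are at least 1, each term
   is at most [D]. *)
have -> : A / (1 + c) - B / (1 + d) =
    (A - B) / (1 + c) + B / (1 + d) * ((d - c) / (1 + c)).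
  by field; rewrite !lt0r_neq0//; lra.
have c1 : 0 <= (1 + c)^-1 <= 1 by rewrite invr_ge0 addr_ge0//= invf_le1; lra.
have d1 : 0 <= (1 + d)^-1 <= 1 by rewrite invr_ge0 addr_ge0//= invf_le1; lra.
move: c1 d1 => /andP[c1 c2] /andP[d1 d2].
apply: le_trans (ler_normD _ _) _; rewrite !normrM.
rewrite (ger0_norm c1) (ger0_norm d1) (ger0_norm (normr_ge0 _ : 0 <= B)).
have h1 : `|A - B| * (1 + c)^-1 <= D by rewrite (le_trans _ AB)// ler_piMr.
have h2 : `|d - c| * (1 + c)^-1 <= D by rewrite distrC (le_trans _ cd)// ler_piMr.
have h3 : B * (1 + d)^-1 <= 1 by rewrite mulr_ile1 ?normr_ge0.
have h4 : B * (1 + d)^-1 * (`|d - c| * (1 + c)^-1) <= D.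
  by rewrite (le_trans _ h2)// ler_piMl// mulr_ge0.
lra.
Qed.

Lemma circle_map_mdim_eq (a : R) : 0 <= a <= 1 ->
  exists phi : S -> S,
    [/\ continuous phi, lower_mdim phi = a%:E & upper_mdim phi = a%:E].
Proof.
move=> a01; apply: (exists_map_mdim_eq _ a01 arc arc_coord 2) => //.
- by rewrite ler1n.
- exact: arc_coord_itv.
- exact: arcK.
- by move=> u v _ _; exact: arc_lip.
- exact: arc_coord_lip.
(* Coordinates in [-1, 1] are halved to fit [0, 1], so cells of length [e / 4] give [e / 2] per
   coordinate and [e] in total. *)
move=> e e0; have e4 : 0 < e / 4 by rewrite divr_gt0.
have half01 (x : R) : `|x| <= 1 -> 0 <= (x + 1) / 2 <= 1.
  by rewrite ler_norml => /andP[? ?]; apply/andP; split; lra.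
have [N1 [c1 c1P]] := @cells_of_unit_valued S (fun p => ((val p).1 + 1) / 2) _ e4
  (fun p => half01 _ (circle_abs_le1 p).1).
have [N2 [c2 c2P]] := @cells_of_unit_valued S (fun p => ((val p).2 + 1) / 2) _ e4
  (fun p => half01 _ (circle_abs_le1 p).2).
exists #|{: 'I_N1 * 'I_N2}|, (fun p => enum_rank (c1 p, c2 p)).
move=> p q /enum_rank_inj[/c1P h1 /c2P h2]; apply: le_trans (circle_dist_le p q) _.
have half (x y : R) : `|(x + 1) / 2 - (y + 1) / 2| <= e / 4 -> `|x - y| <= e / 2.
  by rewrite !ler_norml => /andP[? ?]; apply/andP; split; lra.
have := lerD (half _ _ h1) (half _ _ h2); lra.
Qed.

End Spaces.

Theorem proposition3p5 (R : realType) :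
  (forall a : R, 0 <= a <= 1 ->
     exists phi : unit_interval R -> unit_interval R,
       [/\ continuous phi, lower_mdim phi = a%:E & upper_mdim phi = a%:E]) /\
  (forall a : R, 0 <= a <= 1 ->
     exists phi : circle R -> circle R,
       [/\ continuous phi, lower_mdim phi = a%:E & upper_mdim phi = a%:E]).
Proof.
split=> a a01; [exact: interval_map_mdim_eq|exact: circle_map_mdim_eq].
Qed.
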